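(* Let $\mathcal{H}$ be a real Hilbert space and let $A,B\subseteq\mathcal{H}$ be nonempty, closed and convex subsets with nonempty intersection. Then the following are equivalent: (i) $\{A,B\}$ has the strong CHIP; (ii) for all $q\in\mathcal{H}$, $\; q-P_{A\cap B}(q)\in (N_A+N_B)(P_{A\cap B}(q))$.
   Context: For a nonempty closed convex set $C\subseteq\mathcal{H}$, $P_C$ denotes the projector (nearest point map) onto $C$. For a convex set $C$, the normal cone is $N_C(x)=\{u\in\mathcal{H}\mid\langle u,c-x\rangle\leq 0\ \forall c\in C\}$ if $x\in C$ and $N_C(x)=\emptyset$ otherwise; $(N_A+N_B)(x)=N_A(x)+N_B(x)$ (Minkowski sum). A pair $\{C,D\}$ of closed convex subsets of $\mathcal{H}$ has the strong conical hull intersection property (strong CHIP) at $x\in C\cap D$ if $N_{C\cap D}(x)=N_C(x)+N_D(x)$; it has the strong CHIP if it has the strong CHIP at each $x\in C\cap D$. *)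

(* Defs.v *)
From HB Require Import structures.
From mathcomp Require Import all_boot all_order all_algebra.
From mathcomp Require Import all_classical all_reals all_analysis.

Set Implicit Arguments.
Unset Strict Implicit.
Unset Printing Implicit Defensive.

Import Order.TTheory GRing.Theory Num.Theory.
Import numFieldNormedType.Exports.

Local Open Scope classical_set_scope.
Local Open Scope ring_scope.

(* A real inner product on H is a form dot : {dot H for idfun}: bilinear,
   symmetric and positive definite. H is a Hilbert space for dot when it is
   complete for the norm that dot induces; this predicate says that the norm
   of H is that one. *)
Definition induces_norm (R : realType) (H : normedModType R)
    (dot : {dot H for (@idfun R)}) : Prop :=
  forall x : H, `|x| = Num.sqrt (dot x x).

Definition nearest_points (R : realType) (H : normedModType R)
    (C : set H) (q : H) : set H :=
  [set p | C p /\ forall c, C c -> `|q - p| <= `|q - c|].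

(* The default value 0 is irrelevant when C is nonempty, closed and convex in
   a Hilbert space: q then has exactly one nearest point in C. *)
Definition projector (R : realType) (H : normedModType R)
    (C : set H) (q : H) : H := xget 0 (nearest_points C q).

Definition normal_cone (R : realType) (H : normedModType R)
    (dot : {dot H for (@idfun R)}) (C : set H) (x : H) : set H :=
  [set u | C x /\ forall c, C c -> dot u (c - x) <= 0].

Definition minkowski_sum (R : realType) (H : normedModType R)
    (U V : set H) : set H := [set u + v | u in U & v in V].

Definition strong_CHIP_at (R : realType) (H : normedModType R)
    (dot : {dot H for (@idfun R)}) (C D : set H) (x : H) : Prop :=
  normal_cone dot (C `&` D) x =
  minkowski_sum (normal_cone dot C x) (normal_cone dot D x).

Definition strong_CHIP (R : realType) (H : normedModType R)
    (dot : {dot H for (@idfun R)}) (C D : set H) : Prop :=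
  forall x, (C `&` D) x -> strong_CHIP_at dot C D x.

(* Main.v *)
Require Import Defs.
From HB Require Import structures.
From mathcomp Require Import all_boot all_order all_algebra.
From mathcomp Require Import all_classical all_reals all_analysis.
From mathcomp Require Import ring lra.

Import Order.TTheory GRing.Theory Num.Theory.
Import numFieldNormedType.Exports.

Local Open Scope classical_set_scope.
Local Open Scope ring_scope.

(** The projection p of q onto a closed convex set C exists (the near-minimizers
    of the distance to q form a Cauchy filter, by the parallelogram law) and
    satisfies q - p \in N_C(p); conversely, u \in N_C(x) forces x to be the
    projection of x + u. Hence N_C(x) consists of the vectors q - P_C(q) with
    P_C(q) = x. For C = A `&` B this turns (ii) into the inclusion of
    N_{A `&` B} in N_A + N_B, the opposite inclusion being trivial. *)

Section HilbertProjection.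
Context {R : realType}.

Section InnerProduct.
Context {H : normedModType R} {dot : {dot H for (@idfun R)}}.
Hypothesis dot_norm : induces_norm dot.
Implicit Types (x y u v : H) (C : set H).

Lemma dotC u v : dot u v = dot v u.
Proof. by rewrite (hermC dot) expr0 mul1r. Qed.

Lemma dotZr (a : R) u v : dot u (a *: v) = a * dot u v.
Proof. exact: linearZr_LR. Qed.

Lemma dot_sqr_norm x : dot x x = `|x| ^+ 2.
Proof.
rewrite dot_norm sqr_sqrtr//; have [->|x0] := eqVneq x 0.
  by rewrite linear0r.
by rewrite ltW// neq0_dnorm_gt0.
Qed.

Lemma sqr_normB u v : `|u - v| ^+ 2 = `|u| ^+ 2 - 2 * dot u v + `|v| ^+ 2.
Proof.
rewrite -!dot_sqr_norm (hnormB dot) /= expr0 mul1r; ring.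
Qed.

Lemma parallelogram u v :
  `|u - v| ^+ 2 + `|u + v| ^+ 2 = 2 * `|u| ^+ 2 + 2 * `|v| ^+ 2.
Proof.
rewrite -{2}(opprK v) !sqr_normB normrN linearNr; ring.
Qed.

Lemma convex_segment C x y (t : R) : convex_set C -> C x -> C y ->
  0 <= t -> t <= 1 -> C (x + t *: (y - x)).
Proof.
move=> cC Cx Cy t0 t1.
have := cC y x (Itv01 t0 t1) (mem_set Cy) (mem_set Cx).
move=> /set_mem; congr C.
transitivity (t *: y + (1 - t) *: x); first by [].
by rewrite scalerBr scalerBl scale1r addrCA.
Qed.

(** If some c in C had a positive inner product with q - p, a short move from p towards c would stay
    in C and come strictly closer to q. *)
Lemma nearest_points_normal_cone C q p : convex_set C ->
  nearest_points C q p -> normal_cone dot C p (q - p).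
Proof.
move=> cC [Cp pmin]; split=> // c Cc; rewrite leNgt; apply/negP => a_gt0.
set a := dot _ _ in a_gt0; set b := `|c - p| ^+ 2.
have b_ge0 : 0 <= b by rewrite exprn_ge0.
have ab : 0 < a + b by rewrite ltr_wpDr.
(* The squared distance changes by t * (t * b - 2 * a). This t lies in (0, 1] even when b = 0, and t
   * b < 2 * a, so the change is negative. *)
pose t := a / (a + b).
have t_gt0 : 0 < t by rewrite divr_gt0.
have t_le1 : t <= 1 by rewrite ler_pdivrMr// mul1r lerDl.
have := pmin _ (convex_segment C p c t cC Cp Cc (ltW t_gt0) t_le1).
rewrite -(ler_pXn2r (n := 2)) ?nnegrE// opprD addrA (sqr_normB (q - p)).
rewrite dotZr normrZ exprMn real_normK ?num_real// -/a -/b => le_t.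
have : t * (2 * a - t * b) <= 0 by move: le_t; rewrite expr2; lra.
rewrite pmulr_rle0// subr_le0 /t mulrAC ler_pdivlMr//.
nra.
Qed.

(** Expanding the square gives [|x + u - c|^2 >= |u|^2 + |c - x|^2] for every c in C, so x is
    nearest to x + u and any other nearest point coincides with x. *)
Lemma projector_normal_cone C x u : normal_cone dot C x u ->
  projector C (x + u) = x.
Proof.
move=> [Cx ux].
have dist c : `|x + u - c| ^+ 2 = `|u| ^+ 2 - 2 * dot u (c - x) + `|c - x| ^+ 2.
  by rewrite -sqr_normB opprB addrA (addrC x).
have dx : x + u - x = u by rewrite addrAC subrr add0r.
apply: xget_unique.
  split=> // c Cc; rewrite dx -(ler_pXn2r (n := 2)) ?nnegrE// dist.
  by have := ux _ Cc; have := exprn_ge0 2 (normr_ge0 (c - x)); lra.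
move=> y [Cy /(_ x Cx)]; rewrite dx -(ler_pXn2r (n := 2)) ?nnegrE// dist.
have := ux _ Cy; have := exprn_ge0 2 (normr_ge0 (y - x)) => n0 u0 le0.
have /eqP : `|y - x| ^+ 2 = 0 by lra.
by rewrite sqrf_eq0 normr_eq0 subr_eq0 => /eqP.
Qed.

End InnerProduct.

Lemma nearest_points_nonempty {H : completeNormedModType R}
    {dot : {dot H for (@idfun R)}} (C : set H) (q : H) :
  induces_norm dot -> C !=set0 -> closed C -> convex_set C ->
  nearest_points C q !=set0.
Proof.
move=> dot_norm [c0 Cc0] closedC convexC.
pose E := [set `|q - c| ^+ 2 | c in C].
have infE : has_inf E.
  split; first by exists (`|q - c0| ^+ 2), c0.
  by exists 0 => _ [c _ <-]; rewrite exprn_ge0.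
have infC c : C c -> inf E <= `|q - c| ^+ 2.
  by move=> Cc; apply: ge_inf; [exact: infE.2|exists c].
pose S (e : R) := [set c | C c /\ `|q - c| ^+ 2 < inf E + e].
pose F := filter_from [set e : R | 0 < e] S.
have S0 e : 0 < e -> S e !=set0.
  by move=> e0; have [_ [c Cc <-] ?] := inf_adherent e0 infE; exists c.
have FS e : 0 < e -> F (S e) by move=> e0; exists e.
have FF : ProperFilter F.
  apply: filter_from_proper => //; apply: filter_from_filter.
    by exists 1; rewrite /= ltr01.
  move=> i j i0 j0; exists (Num.min i j); first by rewrite /= lt_min i0.
  by move=> c [Cc]; rewrite -ltrBlDl lt_min !ltrBlDl => /andP[? ?].
(* The midpoint of x and y is in C, so its squared distance to q is at least [inf E]; the
   parallelogram law for q - x and q - y then bounds their difference. *)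
have Sdiam e x y : S e x -> S e y -> `|x - y| ^+ 2 < 4 * e.
  move=> [Cx qx] [Cy qy].
  have yx : y - x = (q - x) - (q - y) by rewrite opprB [RHS]addrC subrKA.
  have half01 : 0 <= 2^-1 :> R /\ 2^-1 <= 1 :> R by lra.
  have /infC := convex_segment C x y 2^-1 convexC Cx Cy half01.1 half01.2.
  have -> : q - (x + 2^-1 *: (y - x)) = 2^-1 *: ((q - x) + (q - y)).
    rewrite yx opprD addrA; move: (q - x) (q - y) => a b.
    have {1}-> : a = 2^-1 *: a + 2^-1 *: a.
      by rewrite -scalerDl -div1r -splitr scale1r.
    by rewrite !scalerDr scalerN opprB addrACA subrr addr0.
  have := parallelogram dot_norm (q - x) (q - y).
  rewrite -yx (distrC y) normrZ exprMn gtr0_norm// expr2; lra.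
have /cauchy_cvg/cvg_ex[p Fp] : cauchy F.
  apply: cauchy_exP => e e0; have e20 : 0 < e ^+ 2 / 4.
    by rewrite divr_gt0 ?exprn_gt0.
  have [x Sx] := S0 _ e20; exists x, (e ^+ 2 / 4) => // y Sy.
  rewrite -ball_normE /ball_ /= -(ltr_pXn2r (n := 2)) ?nnegrE ?(ltW e0)//.
  by have := Sdiam _ _ _ Sx Sy; lra.
(* Near the limit p there are near-minimizers of any quality: [S (d ^+ 2)] and the ball of radius d
   both belong to F, hence meet. *)
have close d : 0 < d -> exists2 c, S (d ^+ 2) c & `|p - c| < d.
  move=> d0; have Fb : F (ball p d) by apply: Fp; exact: nbhsx_ballx.
  have [c [Sc]] := filter_ex (filterI (FS _ (exprn_gt0 2 d0)) Fb).
  by rewrite -ball_normE; exists c.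
exists p; split.
  apply: closedC => B /nbhs_ballP[d /= d0 dB].
  by have [c [Cc _] pc] := close _ d0; exists c; split=> //; apply: dB; rewrite -ball_normE.
move=> c Cc; rewrite leNgt; apply/negP => lt_cp.
(* With d half the gap, the near-minimizer x satisfies [|q - x|^2 < |q - c|^2 + d^2 <= (|q - c| +
   d)^2], so [|q - p| < |q - c| + 2 * d = |q - p|], a contradiction. *)
pose d := (`|q - p| - `|q - c|) / 2.
have d0 : 0 < d by rewrite divr_gt0// subr_gt0.
have [x [_ qx] px] := close _ d0.
have : `|q - x| < `|q - c| + d.
  rewrite -(ltr_pXn2r (n := 2)) ?nnegrE ?addr_ge0 ?(ltW d0)//.
  have := infC _ Cc; have := mulr_ge0 (normr_ge0 (q - c)) (ltW d0).
  by rewrite sqrrD; lra.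
have := ler_distD x q p; rewrite (distrC x p) /d in px *.
lra.
Qed.

End HilbertProjection.

Theorem proposition4p1 (R : realType) (H : completeNormedModType R)
    (dot : {dot H for (@idfun R)}) (dot_norm : induces_norm dot)
    (A B : set H)
    (A_nonempty : A !=set0) (A_closed : closed A) (A_convex : convex_set A)
    (B_nonempty : B !=set0) (B_closed : closed B) (B_convex : convex_set B)
    (AB_nonempty : A `&` B !=set0) :
  strong_CHIP dot A B <->
  (forall q : H,
    minkowski_sum (normal_cone dot A (projector (A `&` B) q))
                  (normal_cone dot B (projector (A `&` B) q))
      (q - projector (A `&` B) q)).
Proof.
split=> [chip q|sum_cones x ABx].
  have AB_convex : convex_set (A `&` B).
    move=> x y l; rewrite !in_setI => /andP[Ax Bx] /andP[Ay By].
    by rewrite A_convex// B_convex.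
  have P_AB : nearest_points (A `&` B) q (projector (A `&` B) q).
    (* Existence of a nearest point rules out the default value 0 of [projector]. *)
    apply: xgetPex; apply: nearest_points_nonempty dot_norm _ _ AB_convex => //.
    exact: closedI.
  rewrite -(chip _ P_AB.1).
  exact: nearest_points_normal_cone.
apply/seteqP; split=> u.
  (* Apply (ii) to q = x + u: its projection is x, so the residual is u. *)
  move=> /[dup] ABu /(projector_normal_cone dot_norm) Pxu.
  by have := sum_cones (x + u); rewrite Pxu addrAC subrr add0r.
move=> [v [Ax vA] [w [Bx wB] <-]]; split=> // c [Ac Bc].
by rewrite linearDl -(addr0 0) lerD ?vA ?wB.
Qed.
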